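(* Let $(\psi_n^{(k)})_{n,k\in\mathbb{N}}$ be an array of real-valued random variables with law $\mathbb{P}$ such that the following assumptions hold: (A1) For all $k,k'\in\mathbb{N}$ with $k\ne k'$, $(\psi_n^{(k)})_{n\in\mathbb{N}}$ and $(\psi_n^{(k')})_{n\in\mathbb{N}}$ are independent. (A2) For all $k\in\mathbb{N}$, $\sup_{n\in\mathbb{N}}|\psi_{n+1}^{(k)}-\psi_n^{(k)}|\le C$ for some $C>0$. (A3) There exist $L\in\mathbb{R}$, $\delta>0$ such that for all $\varepsilon>0$ there is a $C'=C'(\varepsilon)$ for which, for all $n,k\in\mathbb{N}$, $$\mathbb{P}\left(\left|\frac{\psi_n^{(k)}}{n}-L\right|>\varepsilon\right)<\frac{C'}{n^\delta}.$$ Then, for any cooling map $\tau$ satisfying $\lim_{k\to\infty}T_k=\infty$, where $T_k=\tau(k)-\tau(k-1)$, $$\lim_{n\to\infty}\frac1n\left(\sum_{k=1}^{\ell(n)-1}\psi_{T_k}^{(k)}+\psi_{\bar T^n}^{(\ell(n))}\right)=L\qquad\mathbb{P}\text{-a.s.}$$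
   Context: Notation: $\mathbb{N}=\{1,2,\dots\}$, $\mathbb{N}_0=\mathbb{N}\cup\{0\}$. A cooling map is a strictly increasing function $\tau:\mathbb{N}_0\to\mathbb{N}_0$ with $\tau(0)=0$. For $n\in\mathbb{N}_0$, $\ell(n)=\inf\{k:\tau(k)>n\}$ and $\bar T^n=n-\tau(\ell(n)-1)$.
   Formalization: The formal statement sets ψ_0^{(k)}=0 (needed when T̄^n=0) and requires (A2) also at n=0, i.e. |ψ_1^{(k)}|≤C with C uniform in k; with (A2) only for n≥1 the claim fails (ψ_n^{(k)}=X_k, iid heavy-tailed). *)

(* Defs.v *)
From HB Require Import structures.
From mathcomp Require Import all_boot all_order all_algebra.
From mathcomp Require Import all_classical all_reals all_analysis.

Set Implicit Arguments.
Unset Strict Implicit.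
Unset Printing Implicit Defensive.

Import Order.TTheory GRing.Theory Num.Theory.
Import numFieldNormedType.Exports.
Local Open Scope classical_set_scope.

Record coolingMap := CoolingMap {
  cooling_fun :> nat -> nat;
  cooling0 : cooling_fun 0%N = 0%N;
  cooling_incr : forall i j : nat, (i < j)%N -> (cooling_fun i < cooling_fun j)%N
}.

Lemma cooling_exceeds (tau : coolingMap) (n : nat) :
  exists k : nat, (n < tau k)%N.
Proof.
exists n.+1; elim: n => [|n IHn].
  by rewrite -{1}(cooling0 tau); exact: cooling_incr.
exact: leq_ltn_trans IHn (cooling_incr tau (ltnSn n.+1)).
Qed.

(* inf {k | tau k > n}, with [ex_minn] as infimum of a nonempty set of naturals;
   it is positive because tau 0 = 0. *)
Definition ell (tau : coolingMap) (n : nat) : nat :=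
  ex_minn (cooling_exceeds tau n).

(* The subtractions below never truncate: tau is increasing, and
   tau (ell tau n).-1 <= n by minimality of [ell tau n]. *)
Definition cooling_gap (tau : coolingMap) (k : nat) : nat :=
  (tau k - tau k.-1)%N.

Definition Tbar (tau : coolingMap) (n : nat) : nat :=
  (n - tau (ell tau n).-1)%N.

Definition sigma_seq (d : measure_display) (T : measurableType d) (R : realType)
    (X : nat -> T -> R) : set (set T) :=
  <<s [set A | exists n : nat, exists2 B : set R,
                 measurable B & A = X n @^-1` B] >>.

Definition indep_seq (d : measure_display) (T : measurableType d) (R : realType)
    (P : probability T R) (X Y : nat -> T -> R) : Prop :=
  forall A B : set T, sigma_seq X A -> sigma_seq Y B ->
    P (A `&` B) = (P A * P B)%E.

(* Main.v *)
(* Since psi_0^(k) = 0, the quantity of interest is Z_n / n, where Z_n is the sum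
   over all blocks of psi^(k) at the time U_k spent in block k before time n, and
   the U_k sum to n. By (A2), Z is Lipschitz in n, so it suffices to treat the
   times n = j^q, whose consecutive ratios tend to 1. At time n, the error
   |Z_n - L n| is at most eps n plus a constant times W_n, the total length of the
   blocks with |psi^(k)_(U_k) - L U_k| > eps U_k. As T_k tends to infinity, (A3)
   gives E W_n <= K + eps n, where K accounts for the short blocks. Pairwise
   independence and (A3) bound the variance of W_n by C n^(2 - delta) (with
   delta <= 1), so by Chebyshev W_n exceeds K + 2 eps n with probability
   O(n^-delta), which is summable along n = j^q when q delta >= 2, and
   Borel-Cantelli applies. *)
Require Import Defs.
From HB Require Import structures.
From mathcomp Require Import all_boot all_order all_algebra.
From mathcomp Require Import all_classical all_reals all_analysis.
From mathcomp Require Import measurable_realfun lra ring zify.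

Set Implicit Arguments.
Unset Strict Implicit.
Unset Printing Implicit Defensive.

Import Order.TTheory GRing.Theory Num.Theory.
Import numFieldNormedType.Exports.
Local Open Scope classical_set_scope.
Local Open Scope ring_scope.

(** * Chebyshev bound for a weighted sum of pairwise independent indicators *)

Lemma Lfun_indic d (T : measurableType d) (R : realType)
    (P : probability T R) (A : set T) (r : R) :
  measurable A -> 0 < r -> (\1_A : T -> R) \in Lfun P r%:E.
Proof.
move=> mA r0; rewrite inE/=; apply/andP; split; rewrite inE//=.
rewrite /finite_norm unlock poweR_lty//.
rewrite (eq_integral (fun x => (\1_A x)%:E)) => [|x _ /=]; last first.
  by rewrite indicE; case: (x \in A); rewrite ?normr1 ?powR1// normr0 powR0// gt_eqF.
by rewrite integral_indic// setIT (le_lt_trans (probability_le1 P mA)) ?ltry.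
Qed.

Lemma covariance_indic d (T : measurableType d) (R : realType)
    (P : probability T R) (A B : set T) : measurable A -> measurable B ->
  covariance P \1_A \1_B = (P (A `&` B) - P A * P B)%E.
Proof.
move=> mA mB; have mAB := measurableI _ _ mA mB.
have AB : (\1_A * \1_B)%R = \1_(A `&` B) :> (T -> R) by rewrite indicI.
by rewrite covarianceE ?AB ?Lfun_indic// !expectation_indic.
Qed.

Lemma Lfun2_sum d (T : measurableType d) (R : realType)
    (P : probability T R) (X : nat -> T -> R) (n : nat) :
  (forall i, X i \in Lfun P 2%:E) ->
  (fun x => \sum_(i < n) X i x) \in Lfun P 2%:E.
Proof.
move=> X2; elim: n => [|n IHn].
  rewrite (_ : (fun x => _) = cst 0) ?Lfun_cst//.
  by apply/funext => x; rewrite big_ord0.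
rewrite (_ : (fun x => _) = (fun x => \sum_(i < n) X i x) \+ X n).
  by rewrite rpredD ?lee1n.
by apply/funext => x; rewrite big_ord_recr.
Qed.

Lemma variance_sum_uncorrelated d (T : measurableType d) (R : realType)
    (P : probability T R) (X : nat -> T -> R) (n : nat) :
  (forall i, X i \in Lfun P 2%:E) ->
  (forall i j, (i < j < n)%N -> covariance P (X i) (X j) = 0%E) ->
  variance P (fun x => \sum_(i < n) X i x) = (\sum_(i < n) variance P (X i))%E.
Proof.
move=> X2.
have sum0 : (fun x => \sum_(i < 0) X i x) = cst 0.
  by apply/funext => x; rewrite big_ord0.
have sumS m : (fun x => \sum_(i < m.+1) X i x) =
    (fun x => \sum_(i < m) X i x) \+ X m.
  by apply/funext => x; rewrite big_ord_recr.
have S2 m := @Lfun2_sum _ _ _ _ _ m X2.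
elim: n => [|n IHn] X0; first by rewrite sum0 big_ord0 variance_cst.
rewrite sumS varianceD// big_ord_recr IHn; last first.
  by move=> i j /andP[ij jn]; rewrite X0// ij ltnS ltnW.
suff cov0 m : (m <= n)%N ->
    covariance P (fun x => \sum_(i < m) X i x) (X n) = 0%E.
  by rewrite cov0// mule0 adde0.
elim: m => [|m IHm] mn; first by rewrite sum0 covariance_cst_l.
by rewrite sumS covarianceDl// IHm ?(ltnW mn)// add0e X0// mn/=.
Qed.

(** Pairwise independence makes the covariances vanish, so the variance is the sum of [a i ^+ 2]
    times the variances of the indicators, each at most [P (E i)]. Only the upper tail of
    Chebyshev's inequality is kept. *)
Lemma chebyshev_weighted_count d (T : measurableType d) (R : realType)
    (P : probability T R) (E : nat -> set T) (a : nat -> R) (n : nat) (t : R) :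
  (forall i, measurable (E i)) ->
  (forall i j, (i < j < n)%N -> P (E i `&` E j) = (P (E i) * P (E j))%E) ->
  0 < t ->
  (P [set x | \sum_(i < n) a i * fine (P (E i)) + t <=
              \sum_(i < n) a i * \1_(E i) x]%R
    <= (t ^- 2 * \sum_(i < n) a i ^+ 2 * fine (P (E i)))%:E)%E.
Proof.
move=> mE indE t0.
pose X i : T -> R := (a i \o* \1_(E i)).
have I2 i : (\1_(E i) : T -> R) \in Lfun P 2%:E by exact: Lfun_indic.
have L12 (f : T -> R) : f \in Lfun P 2%:E -> f \in Lfun P 1.
  by apply: Lfun_subset12; rewrite fin_num_measure.
have X2 i : X i \in Lfun P 2%:E by apply: Lfun_scale; rewrite ?ler1n.
have W2 := @Lfun2_sum _ _ _ _ _ n X2.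
have mW : measurable_fun setT (fun x => \sum_(i < n) X i x).
  by move: W2; rewrite inE => /andP[/[!inE]].
have WE x : \sum_(i < n) X i x = \sum_(i < n) a i * \1_(E i) x.
  by apply: eq_bigr => i _; rewrite /X/= mulrC.
have fP i : (fine (P (E i)))%:E = P (E i) by rewrite fineK// fin_num_measure.
pose W : {RV P >-> R} := HB.pack (fun x => \sum_(i < n) X i x)
  (@isMeasurableFun.Build _ _ _ _ (fun x => \sum_(i < n) X i x) mW).
have EW : ('E_P[W] = (\sum_(i < n) a i * fine (P (E i)))%:E)%E.
  rewrite -sumEFin /W/=; elim: n {W mW WE W2 indE} => [|m IHm].
    rewrite big_ord0 (_ : (fun x => _) = cst 0) ?expectation_cst//.
    by apply/funext => x; rewrite big_ord0.
  rewrite big_ord_recr/= -IHm -(fP m) EFinM fP.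
  rewrite -expectation_indic// -expectationZl ?L12//.
  rewrite -expectationD ?L12// ?Lfun2_sum//; last exact: X2.
  congr expectation.
  by apply/funext => x; rewrite big_ord_recr.
have VW : ('V_P[W] <= (\sum_(i < n) a i ^+ 2 * fine (P (E i)))%:E)%E.
  rewrite (@variance_sum_uncorrelated _ _ _ _ X)//.
    rewrite -sumEFin; apply: lee_sum => i _.
    rewrite varianceZ// (EFinM _ (fine _)) lee_wpmul2l ?lee_fin ?sqr_ge0//.
    rewrite /variance covariance_indic// setIid -(fP i) -EFinM -EFinB lee_fin.
    by rewrite gerBl// mulr_ge0// fine_ge0.
  move=> i j ijn.
  rewrite /X covarianceZl ?Lfun2_mul_Lfun1 ?L12 ?X2 ?Lfun_cst//.
  rewrite covarianceZr ?Lfun2_mul_Lfun1 ?L12//.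
  by rewrite covariance_indic// indE// subee ?mule0// fin_numM// fin_num_measure.
have := chebyshev W t0; rewrite EW/= => chW.
have {}chW : (P [set x | (t <= `|\sum_(i < n) X i x -
      \sum_(i < n) a i * fine (P (E i))|)%R] <=
    (t ^- 2 * \sum_(i < n) a i ^+ 2 * fine (P (E i)))%:E)%E.
  rewrite (le_trans chW)// (EFinM (t ^- 2)) lee_wpmul2l//.
  by rewrite lee_fin invr_ge0 sqr_ge0.
apply: le_trans chW; apply: le_measure; rewrite ?inE.
- under eq_set do rewrite -WE.
  rewrite -[X in measurable X]setTI; apply: measurable_fun_le => //.
- rewrite -[X in measurable X]setTI; apply: measurable_fun_le => //.
  by apply: measurableT_comp => //; exact: measurable_funB.
- move=> x /=; rewrite -WE => h.
  by rewrite (le_trans _ (ler_norm _))// lerBrDl.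
Qed.

(** * Decomposition of the time before [n] into blocks *)

Lemma cooling_homo (tau : coolingMap) : {homo tau : i j / (i <= j)%N}.
Proof.
move=> i j; rewrite leq_eqVlt => /predU1P[->//|ij].
exact/ltnW/cooling_incr.
Qed.

Lemma leq_cooling (tau : coolingMap) n : (n <= tau n)%N.
Proof.
by elim: n => // n IHn; apply: leq_ltn_trans IHn (cooling_incr tau (ltnSn n)).
Qed.

(* The part of the [i.+1]-st block that lies before time [n]: it is T_(i+1) if
   the block is over, Tbar^n if it is the current one, and 0 if it is to come. *)
Definition block (tau : coolingMap) (n i : nat) : nat :=
  (minn (tau i.+1) n - minn (tau i) n)%N.

Lemma leq_block (tau : coolingMap) m n i :
  (m <= n)%N -> (block tau m i <= block tau n i)%N.
Proof.
by rewrite /block => mn; have := cooling_incr tau (ltnSn i); lia.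
Qed.

Lemma sum_block (tau : coolingMap) n K :
  (\sum_(i < K) block tau n i = minn (tau K) n)%N.
Proof.
rewrite -(big_mkord xpredT (block tau n)) telescope_sumn ?cooling0 ?min0n ?subn0//.
by move=> i j ij; have := cooling_homo tau ij; lia.
Qed.

Lemma sum_block_full (tau : coolingMap) n K :
  (n <= K)%N -> (\sum_(i < K) block tau n i = n)%N.
Proof. by move=> nK; rewrite sum_block; have := leq_cooling tau K; lia. Qed.

(** Blocks before [ell tau n] are over, block [ell tau n] is the current one, and later blocks have
    length 0 and vanish by hypothesis. Any [K > n] reaches the current block, so sums at different
    times can share one index range. *)
Lemma cooled_sumE (tau : coolingMap) (V : nmodType) (f : nat -> nat -> V) n K :
  (forall k, (0 < k)%N -> f k 0%N = 0) -> (n < K)%N ->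
  \sum_(1 <= k < ell tau n) f k (cooling_gap tau k)
      + f (ell tau n) (Tbar tau n)
    = \sum_(i < K) f i.+1 (block tau n i).
Proof.
move=> f0 nK; rewrite /Tbar /ell; case: ex_minnP => -[|l] nl lmin.
  by rewrite cooling0 in nl.
have ln : (tau l <= n)%N by rewrite leqNgt; apply/negP => /lmin; rewrite ltnn.
have lK : (l < K)%N by rewrite (leq_ltn_trans _ nK)// (leq_trans (leq_cooling tau l)).
rewrite big_add1/= -(big_mkord xpredT (fun i => f i.+1 (block tau n i))).
rewrite [RHS](big_cat_nat (n := l.+1))//= [X in _ = _ + X]big1_seq ?addr0.
  rewrite big_nat_recr//=; congr (_ + f _ _); last by rewrite /block; lia.
  apply: eq_big_nat => i /andP[_ il]; congr (f _ _).
  rewrite /block /cooling_gap/=.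
  by have := cooling_homo tau il; have := cooling_homo tau (leqnSn i); lia.
move=> i /andP[_]; rewrite mem_index_iota => /andP[li _].
have -> : block tau n i = 0%N.
  rewrite /block; have := cooling_homo tau li; have := cooling_homo tau (leqnSn i).
  by lia.
exact: f0.
Qed.

(** Only finitely many blocks have [T_k < M]; apart from them only the current block can be short,
    so the bound is uniform in [n]. *)
Lemma short_blocks_bounded (tau : coolingMap) (M : nat) :
  cooling_gap tau k @[k --> \oo] --> \oo ->
  exists K0 : nat, forall n K,
    (\sum_(i < K) (if (block tau n i < M)%N then block tau n i else 0) <= K0)%N.
Proof.
move=> /cvgnyPge /(_ M)[i0 _ gapM]; exists (tau i0 + M)%N => n K.
(* If T_(i+1) >= M, a block with [0 < block tau n i < M] is the current one and
   it started after [n - M], so that [block tau (n - M) i] vanishes. *)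
apply: (@leq_trans
  (\sum_(i < K) (block tau (tau i0) i + (block tau n i - block tau (n - M) i)))%N).
  apply: leq_sum => i _; case: ifPn => // iM.
  have [ii0|i0i] := ltnP i i0.
    rewrite (leq_trans _ (leq_addr _ _))//.
    have := cooling_homo tau ii0; have := cooling_homo tau (leqnSn i).
    by rewrite /block; lia.
  rewrite (leq_trans _ (leq_addl _ _))//.
  have /= := gapM i.+1 (leqW i0i); move: iM.
  by rewrite /block /cooling_gap/=; lia.
(* Both sums telescope: the first is at most [tau i0], the second at most [M]. *)
rewrite big_split/= sumnB; last by move=> i _; apply: leq_block; lia.
by rewrite !sum_block; lia.
Qed.

(** * From a polynomial subsequence to all times *)

Lemma ratio_pow_cvg1 (R : realType) (q : nat) :
  (j.+2%:R / j.+1%:R) ^+ q @[j --> \oo] --> (1 : R).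
Proof.
have : (1 + harmonic j) ^+ q @[j --> \oo] --> ((1 + 0) ^+ q : R).
  apply: (@cvg_comp _ _ _ (fun j => 1 + harmonic j) (fun x : R => x ^+ q)).
    by apply: cvgD; [exact: cvg_cst|exact: cvg_harmonic].
  exact: exprn_continuous.
rewrite addr0 expr1n; apply: cvg_trans; apply: near_eq_cvg; near=> j.
by rewrite -(natr1 j.+1) mulrDl divff ?pnatr_eq0// mul1r.
Unshelve. all: by end_near. Qed.

(* Consecutive powers [j ^ q] have ratio tending to 1, so a Lipschitz sequence
   barely moves between two of them. *)
Lemma lipschitz_subseq_cvg (R : realType) (z : nat -> R) (D L : R) (q : nat) :
  (0 < q)%N ->
  (forall m n, (m <= n)%N -> `|z n - z m| <= D * (n - m)%:R) ->
  (forall eps : R, 0 < eps -> \forall j \near \oo,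
     `|z (j.+1 ^ q)%N - L * (j.+1 ^ q)%:R| <= eps * (j.+1 ^ q)%:R) ->
  n%:R^-1 * z n @[n --> \oo] --> L.
Proof.
move=> q0 zD zL; apply/cvgrPdist_le => eps eps0.
have D0 : 0 <= D by have := zD 0%N 1%N isT; rewrite mulr1; exact: le_trans.
pose D' := D + `|L|; have D'0 : 0 <= D' by rewrite addr_ge0.
pose y n := z n - L * n%:R.
have yD m n : (m <= n)%N -> `|y n - y m| <= D' * (n%:R - m%:R).
  move=> mn; rewrite /y.
  have -> : z n - L * n%:R - (z m - L * m%:R) =
      (z n - z m) - L * (n%:R - m%:R) by ring.
  rewrite (le_trans (ler_normB _ _))// mulrDl lerD//.
    by rewrite -natrB// zD.
  by rewrite normrM -natrB// normr_nat.
have e1 : 0 < eps / 2 by rewrite divr_gt0.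
(* Eventually, between neighbouring powers, [y] moves by at most [D' * e2 <= eps / 2] times
   [j.+1 ^ q]; the [+ 1] guards against [D' = 0]. *)
pose e2 := eps / 2 / (D' + 1).
have e20 : 0 < e2 by rewrite divr_gt0// ltr_wpDl.
have [j0 _ Hj] : \forall j \near \oo, `|y (j.+1 ^ q)%N| <= eps / 2 * (j.+1 ^ q)%:R
    /\ ((j.+2 ^ q)%:R <= (1 + e2) * (j.+1 ^ q)%:R :> R).
  near=> j; split; first by near: j; exact: zL.
  rewrite -ler_pdivrMr ?ltr0n ?expn_gt0// !natrX -expr_div_n.
  rewrite -lerBlDl (le_trans (ler_norm _))// distrC.
  by near: j; move/cvgrPdist_le : (@ratio_pow_cvg1 R q); apply.
exists (j0.+1 ^ q)%N => // n/= jn.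
have n0 : (0 < n)%N by rewrite (leq_trans _ jn)// expn_gt0.
have ub j : (j.+1 ^ q <= n)%N -> (j <= n)%N.
  move=> h; rewrite (leq_trans _ h)// (leq_trans (leqnSn j))//.
  by rewrite -{1}(expn1 j.+1) leq_pexp2l.
(* This brackets [n] between [j.+1 ^ q] and [j.+2 ^ q]. Since [j0] is admissible, the maximal [j] is
   at least [j0], so that [Hj] applies to it. *)
have [j jq jmax] := ex_maxnP (ex_intro (fun j => j.+1 ^ q <= n)%N j0 jn) ub.
have nj : (n <= j.+2 ^ q)%N.
  by rewrite leqNgt; apply/negP => /ltnW/jmax; rewrite ltnn.
have [yj rj] := Hj j (jmax _ jn).
have yn : `|y n| <= eps * n%:R.
  have -> : y n = (y n - y (j.+1 ^ q)%N) + y (j.+1 ^ q)%N by rewrite subrK.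
  rewrite (le_trans (ler_normD _ _))//.
  rewrite (@le_trans _ _ (eps * (j.+1 ^ q)%:R))//; last first.
    by rewrite ler_wpM2l ?(ltW eps0)// ler_nat.
  rewrite [eps]splitr mulrDl lerD// (le_trans (yD _ _ jq))//.
  rewrite (@le_trans _ _ (D' * (e2 * (j.+1 ^ q)%:R)))//.
    rewrite ler_wpM2l// lerBlDr -[X in _ <= _ + X]mul1r -mulrDl addrC.
    by rewrite (le_trans _ rj)// ler_nat.
  rewrite mulrA ler_wpM2r// /e2 mulrA ler_pdivrMr ?ltr_wpDl// mulrC.
  by rewrite ler_wpM2l ?(ltW e1)// lerDl.
have n0R : 0 < n%:R :> R by rewrite ltr0n.
have -> : L - n%:R^-1 * z n = - (y n / n%:R).
  by rewrite /y; field; rewrite gt_eqF.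
by rewrite normrN normrM normfV normr_nat ler_pdivrMr.
Unshelve. all: by end_near. Qed.

(** * Deviation events and their measurability *)

Definition deviation (T : Type) (R : realType) (X : nat -> T -> R) (L eps : R)
    (n : nat) : set T := [set x | eps * n%:R < `|X n x - L * n%:R|].

Lemma deviation0 (T : Type) (R : realType) (X : nat -> T -> R) (L eps : R) :
  (forall x, X 0%N x = 0) -> deviation X L eps 0 = set0.
Proof.
move=> X0; rewrite -subset0 => x; rewrite /deviation/= X0 !mulr0 subrr normr0.
by rewrite ltxx.
Qed.

Lemma measurable_dist_gt (R : realType) (a c : R) :
  measurable [set r : R | c < `|r - a|].
Proof.
rewrite -[X in measurable X]setTI -preimage_itvoy.
have mf : measurable_fun setT (fun r : R => `|r - a|).
  apply: measurableT_comp => //; exact: measurable_funB.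
by apply: mf => //; exact: measurable_itv.
Qed.

Lemma sigma_seq_deviation d (T : measurableType d) (R : realType)
    (X : nat -> T -> R) (L eps : R) (n : nat) :
  (forall x, X 0%N x = 0) ->
  sigma_seq (fun m => X m.+1) (deviation X L eps n).
Proof.
(* Time 0, the length of a block yet to come, is outside the generating family, but its event is
   empty. *)
move=> X0; case: n => [|n].
  by rewrite deviation0//; exact: sigma_algebra0.
apply: sub_sigma_algebra; exists n.
by exists [set r : R | eps * n.+1%:R < `|r - L * n.+1%:R|];
  first exact: measurable_dist_gt.
Qed.

Lemma measurable_deviation d (T : measurableType d) (R : realType)
    (X : nat -> {mfun T >-> R}) (L eps : R) (n : nat) :
  measurable (deviation (fun m => X m : T -> R) L eps n).
Proof. exact: measurable_funPTI (measurable_dist_gt _ _). Qed.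

Lemma deviation_div (T : Type) (R : realType) (X : nat -> T -> R)
    (L eps : R) (n : nat) : (0 < n)%N ->
  deviation X L eps n = [set x | eps < `|X n x / n%:R - L|].
Proof.
move=> n0; have nR : 0 < n%:R :> R by rewrite ltr0n.
apply: eq_set => x.
rewrite (_ : _ / _ - L = (X n x - L * n%:R) / n%:R); last first.
  by rewrite mulrBl mulfK ?gt_eqF.
by rewrite normrM normfV normr_nat ltr_pdivlMr.
Qed.

(** * Decay estimates and the tail of the weighted count of deviating blocks *)

Lemma powR_decay_le (R : realType) (C delta eps : R) :
  0 < delta -> 0 < eps ->
  exists M : nat, forall n, (M <= n)%N -> (0 < n)%N -> C / n%:R `^ delta <= eps.
Proof.
(* Solving the inequality for [n] gives the threshold [C / eps] to the power [delta^-1]; the maximum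
   with 0 covers a negative [C]. *)
move=> d0 e0; pose c := Num.max (C / eps) 0.
have c0 : 0 <= c by rewrite le_max lexx orbT.
exists (Num.truncn (c `^ delta^-1)).+1 => n Mn n0.
have nd : 0 < n%:R `^ delta :> R by rewrite powR_gt0// ltr0n.
rewrite ler_pdivrMr// mulrC -ler_pdivrMr//.
apply: (@le_trans _ _ c); first by rewrite le_max lexx.
have -> : c = (c `^ delta^-1) `^ delta.
  by rewrite -powRrM mulVf ?lt0r_neq0// powRr1.
rewrite ge0_ler_powR ?nnegrE ?powR_ge0// ltW//.
by rewrite (lt_le_trans (truncnS_gt _))// ler_nat.
Qed.

(** Controls one term of the variance. For [m >= 1] the exponent [delta] can be lowered to
    [e = Num.min delta 1], and [m] to the power [1 - e >= 0] is monotone in [m]. For [m = 0] the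
    left side vanishes, so no rate is asked for there. *)
Lemma mul_powR_decay_le (R : realType) (p C delta : R) (m n : nat) :
  0 <= C -> 0 < delta -> ((0 < m)%N -> p <= C / m%:R `^ delta) -> (m <= n)%N ->
  m%:R * p <= C * (n%:R / n%:R `^ Num.min delta 1).
Proof.
move=> C0 d0 pC mn; set e := Num.min delta 1.
have [m0|m0] := posnP m.
  by rewrite m0 mul0r mulr_ge0// divr_ge0// powR_ge0.
have mR : 1 <= m%:R :> R by rewrite ler1n.
have nR : 1 <= n%:R :> R by rewrite ler1n (leq_trans m0).
have powB (k : R) : 1 <= k -> k / k `^ e = k `^ (1 - e).
  move=> k1; rewrite powRB ?powRr1 ?(le_trans _ k1)//.
  by apply/implyP => _; rewrite gt_eqF// (lt_le_trans _ k1).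
apply: (@le_trans _ _ (m%:R * (C / m%:R `^ e))).
  rewrite ler_wpM2l// (le_trans (pC m0))// ler_wpM2l//.
  rewrite lef_pV2 ?posrE ?powR_gt0 ?(lt_le_trans _ mR)//.
  by rewrite ler_powR// ge_min lexx.
rewrite mulrCA ler_wpM2l// !powB// ge0_ler_powR ?nnegrE ?ler_nat//.
by rewrite subr_ge0 ge_min lexx orbT.
Qed.

Lemma nneseries_bounded (R : realType) (u : nat -> \bar R) (M : R) :
  (forall n, 0 <= u n)%E -> (forall n, \sum_(0 <= i < n) u i <= M%:E)%E ->
  (\sum_(i <oo) u i < +oo)%E.
Proof.
move=> u0 uM; rewrite (le_lt_trans _ (ltry M))//.
apply: lime_le; first exact: is_cvg_nneseries.
by apply: nearW => n; exact: uM.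
Qed.

Lemma sum_inv_sqr_le2 (R : realFieldType) (n : nat) :
  \sum_(0 <= i < n) i.+1%:R ^- 2 <= 2 :> R.
Proof.
case: n => [|n]; first by rewrite big_geq.
(* The sharper bound is inductive because [1 / (k + 1)^2 <= 1 / k - 1 / (k + 1)]. *)
suff : \sum_(0 <= i < n.+1) i.+1%:R ^- 2 <= 2 - n.+1%:R^-1 :> R.
  by move=> /le_trans; apply; rewrite gerBl.
elim: n => [|n IHn]; first by rewrite big_nat1 expr1n invr1; lra.
rewrite big_nat_recr//= (le_trans (lerD IHn (lexx _)))//.
rewrite -(natr1 n.+1); have : 0 < n.+1%:R :> R by rewrite ltr0n.
move: n.+1%:R => k k0; rewrite -subr_ge0.
have -> : 2 - (k + 1)^-1 - (2 - k^-1 + (k + 1) ^- 2) = (k * (k + 1) ^+ 2)^-1.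
  by field; rewrite ?gt_eqF//; lra.
by rewrite invr_ge0 mulr_ge0 ?sqr_ge0// ltW.
Qed.

(* The variance of the count is at most
   [\sum U^2 * (C / U^delta) <= C * n^(2 - delta)] for [delta <= 1], since the
   lengths [U] of the blocks sum to [n]; hence the bound [n^-delta]. *)
Lemma deviation_count_tail d (T : measurableType d) (R : realType)
    (P : probability T R) (psi : nat -> nat -> {RV P >-> R})
    (L delta eps C : R) (tau : coolingMap) :
  (forall k, (0 < k)%N -> forall x : T, psi k 0%N x = 0) ->
  (forall k k', (0 < k)%N -> (0 < k')%N -> k <> k' ->
     indep_seq P (fun n => (psi k n.+1 : T -> R))
                 (fun n => (psi k' n.+1 : T -> R))) ->
  0 < delta -> 0 < eps -> 0 <= C ->
  (forall n k, (0 < n)%N -> (0 < k)%N ->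
     P (deviation (fun m => psi k m : T -> R) L eps n)
       <= (C / n%:R `^ delta)%:E)%E ->
  cooling_gap tau k @[k --> \oo] --> \oo ->
  exists K0 : R, forall n, (0 < n)%N ->
    (P [set x | K0 + 2 * eps * n%:R <= \sum_(i < n.+1) (block tau n i)%:R *
         \1_(deviation (fun m => psi i.+1 m : T -> R) L eps (block tau n i)) x]%R
      <= (C / eps ^+ 2 / n%:R `^ Num.min delta 1)%:E)%E.
Proof.
move=> psi0 A1 delta0 eps0 C0 rate T_dvg.
have [M HM] := @powR_decay_le _ C _ _ delta0 eps0.
have [K0 HK0] := short_blocks_bounded M T_dvg.
exists K0%:R => n n0.
pose E i := deviation (fun m => psi i.+1 m : T -> R) L eps (block tau n i).
have mE i : measurable (E i) by exact: measurable_deviation.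
pose p i := fine (P (E i)).
have pE i : (p i)%:E = P (E i) by rewrite /p fineK// fin_num_measure.
have p1 i : p i <= 1 by rewrite -lee_fin pE probability_le1.
have prate i : (0 < block tau n i)%N -> p i <= C / (block tau n i)%:R `^ delta.
  by move=> b0; rewrite -lee_fin pE rate.
have nR : 0 < n%:R :> R by rewrite ltr0n.
have sumb : \sum_(i < n.+1) (block tau n i)%:R = n%:R :> R.
  by rewrite -natr_sum sum_block_full.
(* Blocks shorter than [M] use [p i <= 1] and total at most [K0]; on the longer ones [p i <= eps] by
   the choice of [M]. *)
have mean : \sum_(i < n.+1) (block tau n i)%:R * p i <= K0%:R + eps * n%:R.
  rewrite -sumb mulr_sumr.
  rewrite (@le_trans _ _ (\sum_(i < n.+1)
      ((if block tau n i < M then block tau n i else 0)%N%:R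
        + eps * (block tau n i)%:R)))//.
    apply: ler_sum => i _; case: ltnP => bM.
      by rewrite ler_wpDr ?mulr_ge0 ?(ltW eps0)// ler_piMr.
    rewrite add0r mulrC; have [->|b0] := posnP (block tau n i).
      by rewrite !mulr0.
    by rewrite ler_wpM2r// (le_trans (prate _ b0))// HM.
  by rewrite big_split/= lerD// -natr_sum ler_nat; exact: HK0.
have var : \sum_(i < n.+1) (block tau n i)%:R ^+ 2 * p i <=
    n%:R * (C * (n%:R / n%:R `^ Num.min delta 1)).
  rewrite -{1}sumb mulr_suml; apply: ler_sum => i _.
  rewrite expr2 -mulrA ler_wpM2l//; apply: mul_powR_decay_le => //.
    exact: prate.
  by rewrite -[leqRHS](sum_block_full tau (leqnSn n)) (bigD1 i)//= leq_addr.
have indE i j : (i < j < n.+1)%N -> P (E i `&` E j) = (P (E i) * P (E j))%E.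
  move=> /andP[ij _]; apply: (A1 i.+1 j.+1) => //.
  - by move=> [ij']; rewrite ij' ltnn in ij.
  - by apply: sigma_seq_deviation; exact: psi0.
  - by apply: sigma_seq_deviation; exact: psi0.
(* The mean is at most [K0 + eps * n], so reaching [K0 + 2 * eps * n] means exceeding the mean by at
   least [eps * n]. *)
have t0 : 0 < eps * n%:R by rewrite mulr_gt0.
have := @chebyshev_weighted_count _ _ _ _ _ (fun i => (block tau n i)%:R)
  n.+1 _ mE indE t0.
move=> cheb; apply: (@le_trans _ _ (P [set x | (\sum_(i < n.+1)
      (block tau n i)%:R * p i + eps * n%:R
    <= \sum_(i < n.+1) (block tau n i)%:R * \1_(E i) x)%R])).
  have mW (c : R) : measurable [set x | c <=
      \sum_(i < n.+1) (block tau n i)%:R * \1_(E i) x].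
    rewrite -[X in measurable X]setTI; apply: measurable_fun_le => //.
    apply: measurable_sum => i; apply: measurable_funM => //.
  apply: le_measure; rewrite ?inE// => x /=.
  apply: le_trans.
  by move: mean; lra.
apply: (le_trans cheb); rewrite lee_fin -/(p _).
rewrite (@le_trans _ _ ((eps * n%:R) ^- 2 *
    (n%:R * (C * (n%:R / n%:R `^ Num.min delta 1)))))//.
  by rewrite ler_wpM2l// invr_ge0 sqr_ge0.
rewrite le_eqVlt; apply/orP; left; apply/eqP; field.
by rewrite ?gt_eqF ?powR_gt0.
Qed.

(** * Borel-Cantelli and pathwise estimates for the cooled sum *)

Lemma borel_cantelli_ae d (T : measurableType d) (R : realType)
    (mu : {measure set T -> \bar R}) (F : nat -> set T) :
  (forall j, measurable (F j)) -> (\sum_(j <oo) mu (F j) < +oo)%E ->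
  {ae mu, forall x, \forall j \near \oo, ~ F j x}.
Proof.
move=> mF Foo; exists (lim_sup_set F); split.
- by apply: bigcapT_measurable => n; exact: bigcup_measurable.
- exact: lim_sup_set_cvg0.
- move=> x /= nFx n _; apply: contrapT => Fx; apply: nFx; exists n => // j /= nj.
  by move=> Fj; apply: Fx; exists j.
Qed.

Lemma lipschitz_dist (R : realDomainType) (f : nat -> R) (C : R) (m n : nat) :
  (forall i, `|f i.+1 - f i| <= C) -> (m <= n)%N ->
  `|f n - f m| <= C * (n - m)%:R.
Proof.
move=> fC /subnK <-; rewrite addnK; elim: (n - m)%N => [|k IHk].
  by rewrite add0n subrr normr0 mulr0.
rewrite addSn -(subrKA (f (k + m)%N)) -natr1 mulrDr mulr1 addrC.
by rewrite (le_trans (ler_normD _ _))// lerD.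
Qed.

(** Passing from time [m] to [n] only lengthens blocks, and the increments sum to [n - m]. The sum
    at time [m] is first extended to [n.+1] terms, the added ones being zero. *)
Lemma sum_cooled_lipschitz (R : realType) (tau : coolingMap)
    (f : nat -> nat -> R) (C : R) :
  (forall i, f i.+1 0%N = 0) ->
  (forall i n, `|f i.+1 n.+1 - f i.+1 n| <= C) ->
  forall m n, (m <= n)%N ->
  `|\sum_(i < n.+1) f i.+1 (block tau n i)
     - \sum_(i < m.+1) f i.+1 (block tau m i)| <= C * (n - m)%:R.
Proof.
move=> f0 fC m n mn.
have <- : \sum_(i < n.+1) f i.+1 (block tau m i)
    = \sum_(i < m.+1) f i.+1 (block tau m i).
  rewrite -!(@cooled_sumE tau _ f m) ?ltnS//; by case.
rewrite -sumrB (le_trans (ler_norm_sum _ _ _))//.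
rewrite (@le_trans _ _ (\sum_(i < n.+1) C * (block tau n i - block tau m i)%:R))//.
  by apply: ler_sum => i _; apply: lipschitz_dist => //; exact: leq_block.
rewrite -mulr_sumr -natr_sum sumnB; last by move=> i _; exact: leq_block.
by rewrite !sum_block_full// ltnW// ltnS.
Qed.

(** A block of length [U] outside its deviation event contributes at most [eps * U]. Inside it, as
    the path starts at 0 with increments at most [C], the contribution is at most
    [(C + |L|) * U]. *)
Lemma sum_cooled_dist (R : realType) (tau : coolingMap) (T : Type)
    (f : nat -> nat -> T -> R) (C L eps : R) (x : T) (n : nat) :
  0 < eps ->
  (forall i, f i.+1 0%N x = 0) ->
  (forall i n, `|f i.+1 n.+1 x - f i.+1 n x| <= C) ->
  `|\sum_(i < n.+1) f i.+1 (block tau n i) x - L * n%:R| <=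
    eps * n%:R + (C + `|L|) * \sum_(i < n.+1) (block tau n i)%:R *
      \1_(deviation (f i.+1) L eps (block tau n i)) x.
Proof.
move=> eps0 f0 fC.
have sumb : \sum_(i < n.+1) (block tau n i)%:R = n%:R :> R.
  by rewrite -natr_sum sum_block_full.
rewrite -sumb !mulr_sumr -sumrB -big_split/= (le_trans (ler_norm_sum _ _ _))//.
apply: ler_sum => i _; set U := block tau n i.
rewrite indicE; case: (boolP (x \in _)) => [_|].
  rewrite mulr1 (le_trans (ler_normB _ _))// normrM normr_nat mulrDl.
  rewrite ler_wpDl ?mulr_ge0 ?(ltW eps0)// lerD2r.
  have := @lipschitz_dist _ (fun n => f i.+1 n x) C 0%N U (fC i) (leq0n _).
  by rewrite f0 subr0 subn0.
rewrite notin_setE /deviation/= => /negP; rewrite -leNgt => /le_trans; apply.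
by rewrite !mulr0 addr0.
Qed.

(** * Almost sure convergence *)

Lemma deviation_count_ae d (T : measurableType d) (R : realType)
    (P : probability T R) (psi : nat -> nat -> {RV P >-> R})
    (L delta eps C : R) (tau : coolingMap) (q : nat) :
  (forall k, (0 < k)%N -> forall x : T, psi k 0%N x = 0) ->
  (forall k k', (0 < k)%N -> (0 < k')%N -> k <> k' ->
     indep_seq P (fun n => (psi k n.+1 : T -> R))
                 (fun n => (psi k' n.+1 : T -> R))) ->
  0 < delta -> 0 < eps -> 0 <= C ->
  (forall n k, (0 < n)%N -> (0 < k)%N ->
     P (deviation (fun m => psi k m : T -> R) L eps n)
       <= (C / n%:R `^ delta)%:E)%E ->
  cooling_gap tau k @[k --> \oo] --> \oo ->
  2 <= q%:R * Num.min delta 1 ->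
  exists K0 : R, {ae P, forall x, \forall j \near \oo,
    \sum_(i < (j.+1 ^ q).+1) (block tau (j.+1 ^ q) i)%:R *
      \1_(deviation (fun m => psi i.+1 m : T -> R) L eps
            (block tau (j.+1 ^ q) i)) x < K0 + 2 * eps * (j.+1 ^ q)%:R}.
Proof.
move=> psi0 A1 delta0 eps0 C0 rate T_dvg q2.
have [K0 tail] := deviation_count_tail psi0 A1 delta0 eps0 C0 rate T_dvg.
exists K0.
pose F j := [set x | K0 + 2 * eps * (j.+1 ^ q)%:R <=
  \sum_(i < (j.+1 ^ q).+1) (block tau (j.+1 ^ q) i)%:R *
      \1_(deviation (fun m => psi i.+1 m : T -> R) L eps
            (block tau (j.+1 ^ q) i)) x].
have FP j : (P (F j) <= (C / eps ^+ 2 * j.+1%:R ^- 2)%:E)%E.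
  rewrite (le_trans (tail _ _)) ?expn_gt0// lee_fin ler_wpM2l ?divr_ge0 ?sqr_ge0//.
  have j1 : 1 <= j.+1%:R :> R by rewrite ler1n.
  (* Raising [j.+1 ^ q] to the power [Num.min delta 1] gives [j.+1] to the power
     [q * Num.min delta 1 >= 2], so the tails are summable in [j]. *)
  rewrite lef_pV2 ?posrE ?exprn_gt0 ?powR_gt0 ?ltr0n ?expn_gt0//.
  rewrite natrX -[X in X `^ _]powR_mulrn// -powRrM -powR_mulrn//.
  by rewrite ler_powR.
have mF j : measurable (F j).
  rewrite -[X in measurable X]setTI; apply: measurable_fun_le => //.
  apply: measurable_sum => i; apply: measurable_funM => //.
  by apply: measurable_indic; exact: measurable_deviation.
have Foo : (\sum_(j <oo) P (F j) < +oo)%E.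
  apply: (@nneseries_bounded _ _ (C / eps ^+ 2 * 2)) => [//|n].
  rewrite (le_trans (lee_sum _ (fun j _ => FP j)))// sumEFin lee_fin -mulr_sumr.
  by rewrite ler_wpM2l ?sum_inv_sqr_le2// divr_ge0// sqr_ge0.
have := borel_cantelli_ae mF Foo; apply: filterS => x; apply: filterS => j /=.
by move=> /negP; rewrite -ltNge.
Qed.

(* [psi k n] is psi_n^(k); the blocks are k >= 1, and psi_0^(k) = 0. *)
Theorem theorem3 (d : measure_display) (T : measurableType d) (R : realType)
  (P : probability T R) (psi : nat -> nat -> {RV P >-> R})
  (psi0 : forall k : nat, (0 < k)%N -> forall x : T, psi k 0%N x = 0)
  (A1 : forall k k' : nat, (0 < k)%N -> (0 < k')%N -> k <> k' ->
     indep_seq P (fun n : nat => (psi k n.+1 : T -> R))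
                 (fun n : nat => (psi k' n.+1 : T -> R)))
  (A2 : exists2 C : R, 0 < C &
     forall k : nat, (0 < k)%N ->
       {ae P, forall x : T, forall n : nat, `|psi k n.+1 x - psi k n x| <= C})
  (L delta : R) (delta_gt0 : 0 < delta)
  (A3 : forall eps : R, 0 < eps -> exists C' : R,
     forall n k : nat, (0 < n)%N -> (0 < k)%N ->
       (P [set x : T | (eps < `|psi k n x / n%:R - L|)%R]
          < (C' / (n%:R `^ delta))%:E)%E)
  (tau : coolingMap)
  (T_dvg : cooling_gap tau k @[k --> \oo] --> \oo) :
  {ae P, forall x : T,
     n%:R^-1 * (\sum_(1 <= k < ell tau n) psi k (cooling_gap tau k) x
                + psi (ell tau n) (Tbar tau n) x)
       @[n --> \oo] --> L}.
Proof.
case: A2 => C C0 A2.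
have d1 : 0 < Num.min delta 1 by rewrite lt_min delta_gt0 ltr01.
pose q := (Num.truncn (2 / Num.min delta 1)).+1.
have q2 : 2 <= q%:R * Num.min delta 1.
  by rewrite -ler_pdivrMr// ltW// truncnS_gt.
have count eps : 0 < eps -> exists K0 : R, {ae P, forall x, \forall j \near \oo,
    \sum_(i < (j.+1 ^ q).+1) (block tau (j.+1 ^ q) i)%:R *
      \1_(deviation (fun m => psi i.+1 m : T -> R) L eps
            (block tau (j.+1 ^ q) i)) x < K0 + 2 * eps * (j.+1 ^ q)%:R}.
  move=> eps0; have [C' HC'] := A3 eps eps0.
  (* The strict inequality of [A3] at [n = k = 1] forces [C'] to be positive. *)
  have C'0 : 0 <= C'.
    have := HC' 1%N 1%N isT isT; rewrite powR1 divr1 => /(le_lt_trans _).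
    by move=> /(_ _ (measure_ge0 _ _)); rewrite lte_fin => /ltW.
  apply: (deviation_count_ae psi0 A1 delta_gt0 eps0 C'0 _ T_dvg q2) => n k n0 k0.
  by rewrite deviation_div// ltW// HC'.
(* Countably many tolerances suffice, each with its own constant [K0], so the exceptional null sets
   can be united. *)
pose e m : R := m.+1%:R^-1.
have e0 m : 0 < e m by rewrite invr_gt0.
have {}count m := cid (count (e m) (e0 m)).
have ae1 : {ae P, forall x, forall k, (0 < k)%N ->
    forall n, `|psi k n.+1 x - psi k n x| <= C}.
  apply: ae_foralln => -[|k]; first exact: nearW.
  by apply: filterS (A2 k.+1 isT).
have ae2 := ae_foralln (fun m => projT2 (count m)).
apply: filterS2 ae1 ae2 => x xC xcount.
pose z n := \sum_(i < n.+1) psi i.+1 (block tau n i) x.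
have -> : (fun n => n%:R^-1 * (\sum_(1 <= k < ell tau n) psi k (cooling_gap tau k) x
    + psi (ell tau n) (Tbar tau n) x)) = (fun n => n%:R^-1 * z n).
  apply/funext => n; congr (_ * _).
  by apply: (@cooled_sumE _ _ (fun k n => psi k n x)) => // k k0; exact: psi0.
apply: (@lipschitz_subseq_cvg _ z C L q) => // [m n|eps eps0].
  apply: (@sum_cooled_lipschitz _ tau (fun k n => psi k n x)) => // i *.
    exact: psi0.
  exact: xC.
pose D := C + `|L|.
have D0 : 0 < D by rewrite ltr_wpDr.
(* At time [n] the error is at most [e m * n] plus [D] times the weighted count, which is eventually
   at most [3 * e m * n]. *)
have [m em] : exists m, e m * (1 + 3 * D) <= eps.
  exists (Num.truncn ((1 + 3 * D) / eps)).
  rewrite /e mulrC ler_pdivrMr// -ler_pdivrMl// mulrC.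
  by rewrite ltW// truncnS_gt.
move: (xcount m); case: (count m) => K0 /= _ xK0.
near=> j.
have Wj : \sum_(i < (j.+1 ^ q).+1) (block tau (j.+1 ^ q) i)%:R *
      \1_(deviation (fun m => psi i.+1 m : T -> R) L (e m)
            (block tau (j.+1 ^ q) i)) x < K0 + 2 * e m * (j.+1 ^ q)%:R.
  by near: j.
(* As [K0] does not depend on [j], it is eventually absorbed, since [j.+1 ^ q >= j]. *)
have K0j : K0 <= e m * (j.+1 ^ q)%:R.
  rewrite -ler_pdivrMl//; apply: (@le_trans _ _ j%:R).
    by near: j; exact: nbhs_infty_ger.
  by rewrite ler_nat (leq_trans (leqnSn j))// -{1}(expn1 j.+1) leq_pexp2l.
have := @sum_cooled_dist _ tau _ (fun k n => psi k n : T -> R) C L (e m) x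
  (j.+1 ^ q) (e0 m) (fun i => psi0 i.+1 isT x) (fun i => xC i.+1 isT).
move=> /le_trans; apply.
apply: (@le_trans _ _ (e m * (1 + 3 * D) * (j.+1 ^ q)%:R)); last by rewrite ler_wpM2r.
rewrite (_ : e m * (1 + 3 * D) * _ = e m * (j.+1 ^ q)%:R +
  D * (3 * (e m * (j.+1 ^ q)%:R))); last by ring.
rewrite lerD2l ler_wpM2l ?(ltW D0)// (le_trans (ltW Wj))//.
by move: K0j; lra.
Unshelve. all: by end_near. Qed.
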